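(* For every integer $n\ge0$, for butterfly trees $\mathcal T_n^{\mathrm B}$ with $N=2^n$ nodes, $$\#\{\mathcal T_n^{\mathrm B}:\operatorname{HS}(\mathcal T_n^{\mathrm B})=0\}=2^n.$$
   Context: A rooted binary tree is a finite nonempty rooted tree in which each node has at most one left child and at most one right child (left and right distinguished). The Horton--Strahler (HS) number of a node $v$ is: $0$ if $v$ has no children; the HS number of the child if $v$ has exactly one child; and $\max(\operatorname{HS}(v_\ell),\operatorname{HS}(v_r))+\mathbf 1_{\{\operatorname{HS}(v_\ell)=\operatorname{HS}(v_r)\}}$ if $v$ has children $v_\ell,v_r$. $\operatorname{HS}(\mathcal T)$ is the HS number of the root of $\mathcal T$. $\mathcal T_1\oplus\mathcal T_2$ is obtained by making the root of $\mathcal T_2$ the right child of the last node of the path from the root of $\mathcal T_1$ that always moves to the right child; $\mathcal T_1\ominus\mathcal T_2$ is obtained by making the root of $\mathcal T_2$ the left child of the last node of the path from the root of $\mathcal T_1$ that always moves to the left child. Butterfly trees: the only butterfly tree with $2^0$ nodes is the single-node tree; the butterfly trees with $2^{n+1}$ nodes are exactly the trees $\mathcal T\oplus\widetilde{\mathcal T}$ and $\mathcal T\ominus\widetilde{\mathcal T}$, where $\mathcal T,\widetilde{\mathcal T}$ are (not necessarily equal) butterfly trees with $2^n$ nodes. The count is of distinct butterfly trees (as binary tree shapes), of which there are $2^{2^n-1}$ in total. *)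

(* Defs.v *)
From mathcomp Require Import all_boot.
From mathcomp Require Import classical_sets functions cardinality.

Set Implicit Arguments.
Unset Strict Implicit.
Unset Printing Implicit Defensive.

(* Finite nonempty rooted binary trees, by which children the root has: none,
   only a left one, only a right one, or both. *)
Inductive bintree : Type :=
| Leaf
| LeftOnly of bintree
| RightOnly of bintree
| Both of bintree & bintree.

Fixpoint nnodes (t : bintree) : nat :=
  match t with
  | Leaf => 1
  | LeftOnly l => (nnodes l).+1
  | RightOnly r => (nnodes r).+1
  | Both l r => (nnodes l + nnodes r).+1
  end.

(* Horton--Strahler number of the root; the boolean is coerced to 0 or 1. *)
Fixpoint HS (t : bintree) : nat :=
  match t with
  | Leaf => 0
  | LeftOnly l => HS l
  | RightOnly r => HS r
  | Both l r => maxn (HS l) (HS r) + (HS l == HS r)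
  end.

(* Attach the root of [t2] as the right child of the last node of the path
   from the root of [t1] that always moves to the right child. *)
Fixpoint oplus (t1 t2 : bintree) : bintree :=
  match t1 with
  | Leaf => RightOnly t2
  | LeftOnly l => Both l t2
  | RightOnly r => RightOnly (oplus r t2)
  | Both l r => Both l (oplus r t2)
  end.

(* The mirror image of [oplus], along the path of left children. *)
Fixpoint ominus (t1 t2 : bintree) : bintree :=
  match t1 with
  | Leaf => LeftOnly t2
  | LeftOnly l => LeftOnly (ominus l t2)
  | RightOnly r => Both t2 r
  | Both l r => Both (ominus l t2) r
  end.

(* [butterfly n t]: [t] is a butterfly tree with [2 ^ n] nodes; the index is
   the exponent, see [butterfly_nnodes]. *)
Inductive butterfly : nat -> bintree -> Prop :=
| butterfly_leaf : butterfly 0 Leaf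
| butterfly_oplus n t t' :
    butterfly n t -> butterfly n t' -> butterfly n.+1 (oplus t t')
| butterfly_ominus n t t' :
    butterfly n t -> butterfly n t' -> butterfly n.+1 (ominus t t').

Lemma nnodes_oplus t1 t2 : nnodes (oplus t1 t2) = nnodes t1 + nnodes t2.
Proof.
by elim: t1 => //= [r ->|l _ r ->]; rewrite ?addSn // addnA.
Qed.

Lemma nnodes_ominus t1 t2 : nnodes (ominus t1 t2) = nnodes t1 + nnodes t2.
Proof.
elim: t1 => //= [l ->|r _|l -> r _]; rewrite ?addSn //.
- by rewrite addnC.
- by rewrite addnAC.
Qed.

Lemma butterfly_nnodes n t : butterfly n t -> nnodes t = 2 ^ n.
Proof.
elim=> // {}n t1 t2 _ e1 _ e2; rewrite ?nnodes_oplus ?nnodes_ominus.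
- by rewrite e1 e2 expnS mul2n addnn.
- by rewrite e1 e2 expnS mul2n addnn.
Qed.

(* Main.v *)
Require Import Defs.
From mathcomp Require Import all_boot.
From mathcomp Require Import classical_sets functions cardinality.

(* A tree has HS number 0 iff no node has two children, and [oplus t1 t2] has
   this property only if [t1] is a path of right children (dually for
   [ominus]).  So the HS-0 butterfly trees of order n+1 are exactly those of
   order n prolonged upwards by 2^n steps all in the same direction: one free
   bit per level. *)

Local Open Scope classical_set_scope.
Local Open Scope card_scope.

Definition only_child (right : bool) : bintree -> bintree :=
  if right then RightOnly else LeftOnly.

(** The head of [s] is the direction of the last, topmost merge; the stretch it adds has as many
    nodes as [path_tree s'], so each letter doubles the size. *)
Fixpoint path_tree (s : seq bool) : bintree :=
  if s is b :: s' then iter (2 ^ size s') (only_child b) (path_tree s')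
  else Leaf.

Lemma HS_Both_gt0 (l r : bintree) : 0 < HS (Both l r).
Proof. by rewrite /=; case: (HS l) (HS r) => [|a] [|b]; rewrite // maxnSS. Qed.

(** In [oplus t1 t2] every node of the right spine of [t1] has a right child, so a left child
    anywhere on that spine would create a branching node. *)
Lemma HS_oplus_eq0 (t1 t2 : bintree) : HS (oplus t1 t2) = 0 ->
  HS t2 = 0 /\ oplus t1 t2 = iter (nnodes t1) RightOnly t2.
Proof.
elim: t1 => [|l _|r IH|l _ r _] //.
- by move=> h; have := HS_Both_gt0 l t2; rewrite [HS _]h.
- by move=> /= /IH[-> ->].
- by move=> h; have := HS_Both_gt0 l (oplus r t2); rewrite [HS _]h.
Qed.

Lemma HS_ominus_eq0 (t1 t2 : bintree) : HS (ominus t1 t2) = 0 ->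
  HS t2 = 0 /\ ominus t1 t2 = iter (nnodes t1) LeftOnly t2.
Proof.
elim: t1 => [|l IH|r _|l _ r _] //.
- by move=> /= /IH[-> ->].
- by move=> h; have := HS_Both_gt0 t2 r; rewrite [HS _]h.
- by move=> h; have := HS_Both_gt0 (ominus l t2) r; rewrite [HS _]h.
Qed.

Lemma oplus_right_path (k : nat) (t : bintree) :
  oplus (iter k RightOnly Leaf) t = iter k.+1 RightOnly t.
Proof. by elim: k => //= k ->. Qed.

Lemma ominus_left_path (k : nat) (t : bintree) :
  ominus (iter k LeftOnly Leaf) t = iter k.+1 LeftOnly t.
Proof. by elim: k => //= k ->. Qed.

Lemma butterfly_prolong (n : nat) (b : bool) (t : bintree) :
  butterfly n t -> butterfly n.+1 (iter (2 ^ n) (only_child b) t).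
Proof.
have pow_gt0 m : 0 < 2 ^ m by rewrite expn_gt0.
have straight m : butterfly m (iter (2 ^ m).-1 (only_child b) Leaf).
  elim: m => [|m IH]; first exact: butterfly_leaf.
  (* Counting edges: those of the two straight halves, plus the one joining them. *)
  have -> : (2 ^ m.+1).-1 = (2 ^ m).-1.+1 + (2 ^ m).-1.
    by rewrite prednK // -!subn1 addnBA // addnn -mul2n -expnS.
  rewrite iterD; case: b IH => IH.
  - by rewrite -oplus_right_path; apply: butterfly_oplus.
  - by rewrite -ominus_left_path; apply: butterfly_ominus.
(* The added stretch is itself the straight butterfly tree, with [t] hung below its last node. *)
rewrite -(prednK (pow_gt0 n)); case: b straight => /(_ n) Bn Bt.
- by rewrite -oplus_right_path; apply: butterfly_oplus.
- by rewrite -ominus_left_path; apply: butterfly_ominus.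
Qed.

Lemma butterfly_path_tree (s : seq bool) : butterfly (size s) (path_tree s).
Proof.
by elim: s => [|b s IH]; [exact: butterfly_leaf | exact: butterfly_prolong].
Qed.

Lemma HS_iter_only_child (k : nat) (b : bool) (t : bintree) :
  HS (iter k (only_child b) t) = HS t.
Proof. by elim: k => //= k <-; case: b. Qed.

Lemma HS_path_tree (s : seq bool) : HS (path_tree s) = 0.
Proof. by elim: s => //= b s IH; rewrite HS_iter_only_child. Qed.

Lemma butterfly_HS0_path_tree (n : nat) (t : bintree) :
  butterfly n t -> HS t = 0 -> exists2 s, size s = n & path_tree s = t.
Proof.
(* Only the node count of the upper tree [t1] is kept: its shape is forced, and [t2] supplies the
   remaining letters. *)
elim=> [|{}n t1 t2 /butterfly_nnodes n1 _ _ IH|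
         {}n t1 t2 /butterfly_nnodes n1 _ _ IH].
- by exists [::].
- move=> /HS_oplus_eq0[/IH[s sz <-] ->].
  exists (true :: s) => /=; last by rewrite n1 sz.
  by rewrite sz.
- move=> /HS_ominus_eq0[/IH[s sz <-] ->].
  exists (false :: s) => /=; last by rewrite n1 sz.
  by rewrite sz.
Qed.

Lemma iter_only_child_inj (k : nat) (b b' : bool) (t t' : bintree) : 0 < k ->
  iter k (only_child b) t = iter k (only_child b') t' -> b = b' /\ t = t'.
Proof.
(* As the stretch is nonempty, the root constructor reveals the direction. *)
case: k => // k _ e; have eb : b = b' by move: e => /=; case: b; case: b'.
split=> //; move: e; rewrite -{b'}eb; elim: k.+1 => //= m IH.
by case: b IH => IH [/IH].
Qed.

(** Equal sizes give both top stretches the same positive length, so they can be compared and peeled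
    off together. *)
Lemma path_tree_inj (s s' : seq bool) : size s = size s' ->
  path_tree s = path_tree s' -> s = s'.
Proof.
elim: s s' => [|b s IH] [|b' s'] //= [sz]; rewrite sz.
by move=> /iter_only_child_inj[|-> /(IH _ sz) ->]; rewrite ?expn_gt0.
Qed.

Theorem proposition9 (n : nat) :
  [set t : bintree | butterfly n t /\ HS t = 0%N] #= `I_(2 ^ n)%N.
Proof.
have <- : #|{:n.-tuple bool}| = 2 ^ n by rewrite card_tuple card_bool.
(* Words are indexed by ordinals so that [card_II] turns the initial segment into the domain of an
   injection. *)
pose f (i : 'I_#|{:n.-tuple bool}|) := path_tree (enum_val i).
have -> : [set t : bintree | butterfly n t /\ HS t = 0%N] = f @` setT.
  apply/seteqP; split=> t /=.
  - move=> [Bt HSt].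
    have [s /eqP sz <-] := butterfly_HS0_path_tree n t Bt HSt.
    by exists (enum_rank (Tuple sz)) => //; rewrite /f enum_rankK.
  - move=> [i _ <-]; split; last exact: HS_path_tree.
    by have := butterfly_path_tree (enum_val i); rewrite size_tuple.
rewrite (card_eqr card_II); apply: inj_card_eq => i j _ _ eq_f.
by apply/enum_val_inj/val_inj/(path_tree_inj _ _ _ eq_f); rewrite !size_tuple.
Qed.
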